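(* Let $\mu=\sum_{i=1}^n p_i\delta_{x_i}$ with $x_1<\dots<x_n$, $p_i>0$, $\sum_{i=1}^n p_i=1$, be a fixed probability measure on $\mathbb{R}$. For each $N\in\mathbb{N}$ let $\sigma_N=\sum_{j=1}^{m_N} q_j^{(N)}\delta_{y_j^{(N)}}$ with $y_1^{(N)}<\dots<y_{m_N}^{(N)}$ be a probability measure on $\mathbb{R}$ with strictly positive masses $q_j^{(N)}>0$ satisfying $\sum_{j=1}^{m_N}q_j^{(N)}=1$. Let $T_N=F_\mu^{-1}\circ F_{\sigma_N}$ be the discrete cumulative distribution transform of $\mu$ relative to $\sigma_N$, and let $\widetilde\mu_N=(T_N)_\#\sigma_N$. Assume that $$\max_{1\le j\le m_N} q_j^{(N)}\to 0\qquad\text{as } N\to\infty.$$ Then $$\lim_{N\to\infty}\|F_{\widetilde\mu_N}-F_\mu\|_\infty=0,$$ where $\|\cdot\|_\infty$ is the supremum norm over $\mathbb{R}$. Consequently, $\widetilde\mu_N$ converges weakly to $\mu$ as $N\to\infty$.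
   Context: For a Borel probability measure $\mu$ on $\mathbb{R}$, $F_\mu(x)=\mu((-\infty,x])$ is its cumulative distribution function, and its generalized inverse is $F_\mu^{-1}(s)=\inf\{x\in\mathbb{R}: F_\mu(x)\ge s\}$ for $s\in(0,1]$. The discrete cumulative distribution transform (CDT) of $\mu$ relative to an atomic reference measure $\sigma$ is the map $T=F_\mu^{-1}\circ F_\sigma$, determined by its values on the support of $\sigma$. The pushforward is $(T_\#\sigma)(A)=\sigma(T^{-1}(A))$ for Borel sets $A$. $\delta_x$ is the Dirac mass at $x$. *)

(* Defs.v *)
From HB Require Import structures.
From mathcomp Require Import all_boot all_order all_algebra.
From mathcomp Require Import all_classical all_reals all_analysis.
From mathcomp Require Import measurable_realfun.

Set Implicit Arguments.
Unset Strict Implicit.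
Unset Printing Implicit Defensive.

Import Order.TTheory GRing.Theory Num.Theory.
Import numFieldNormedType.Exports.

Local Open Scope classical_set_scope.
Local Open Scope ring_scope.

(* Borel probability measures on the real line. *)
Notation borel_prob R := (probability (measurableTypeR R) R).

Definition atomic (R : realType) (n : nat) (p x : 'I_n -> R)
    (A : set (measurableTypeR R)) : \bar R :=
  (\sum_(i < n) (p i)%:E * \d_(x i) A)%E.

(* [cdf] of the library is attached to a random variable and takes values in
   the extended reals; this one is attached to a measure and is real-valued. *)
Definition cumul (R : realType) (mu : borel_prob R) (x : R) : R :=
  fine (mu `]-oo, x]%classic).

(* Meant for 0 < s <= 1. Where the infimum does not exist in R the value is the
   library's default 0; this happens for s <= 0, for 1 < s, and for s = 1 when
   [cumul mu] does not reach 1. *)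
Definition quantile (R : realType) (mu : borel_prob R) (s : R) : R :=
  inf [set x | s <= cumul mu x].

(* The conventional value of [quantile] at 0 is only used at the points where
   [cumul sigma] vanishes: for an atomic [sigma], to the left of its first
   atom, which is a [sigma]-null set. *)
Definition cdt (R : realType) (mu sigma : borel_prob R)
    : measurableTypeR R -> measurableTypeR R :=
  quantile mu \o cumul sigma.

Section cdt_measurable.
Context (R : realType).
Implicit Types mu sigma : borel_prob R.

Lemma cumul_nondecreasing mu : nondecreasing_fun (cumul mu).
Proof.
move=> r s rs; rewrite /cumul fine_le ?fin_num_measure//.
by rewrite le_measure ?inE//; exact: subitvPr.
Qed.

Lemma measurable_cumul mu : measurable_fun setT (cumul mu).
Proof. exact: nondecreasing_measurable (cumul_nondecreasing mu). Qed.

Lemma measurable_quantile mu : measurable_fun setT (quantile mu).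
Proof.
pose S s := [set x | s <= cumul mu x].
have SS s t : s <= t -> S t `<=` S s by move=> st x /=; exact: le_trans.
pose D := [set s | has_inf (S s)].
have itvD : is_interval D.
  move=> s t [_ [l lS]] [[x tx] _] u /andP[su ut]; split.
    by exists x; exact: SS ut _ tx.
  by exists l => y /(SS _ _ su); exact: lS.
have mD : measurable D by exact: is_interval_measurable.
rewrite -(setUv D); apply/measurable_funU; [exact: mD|exact: measurableC|].
split; last first.
  apply: (@eq_measurable_fun _ _ _ _ _ (cst (0 : R)) _ _ (measurable_cst _)).
  by move=> s; rewrite inE => nD; rewrite /quantile inf_out.
apply: (measurability (@RGenCInfty.G R)).
  exact: RGenCInfty.measurableE.
move=> /= _ [_] [r] -> <-; apply: is_interval_measurable.
move=> s t [Ds rs] [Dt rt] u /andP[su ut].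
have Du : D u by apply: (itvD s t) => //; rewrite su.
split=> //; move: rs; rewrite /= !in_itv/= !andbT => /le_trans; apply.
rewrite /quantile; apply: lb_le_inf; first exact: Du.1.
by move=> x /(SS _ _ su) Sx; apply: ge_inf => //; exact: Ds.2.
Qed.

Lemma measurable_cdt mu sigma : measurable_fun setT (cdt mu sigma).
Proof.
exact: measurableT_comp (measurable_quantile mu) (measurable_cumul sigma).
Qed.

HB.instance Definition _ mu sigma := @isMeasurableFun.Build _ _ _ _
  (cdt mu sigma) (measurable_cdt mu sigma).

End cdt_measurable.

(* [distribution sigma T] is the library's pushforward of [sigma] by the
   measurable map [T], bundled as a probability measure. *)
Definition push_cdt (R : realType) (mu sigma : borel_prob R) : borel_prob R :=
  distribution sigma (cdt mu sigma).

Definition supnorm (R : realType) (f : R -> R) : \bar R :=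
  ereal_sup (range (fun x => `|f x|%:E)).

Definition weak_cvg (R : realType) (nu : nat -> borel_prob R)
    (mu : borel_prob R) : Prop :=
  forall f : R -> R, continuous f -> bounded_fun f ->
    (\int[nu N]_x (f x)%:E @[N --> \oo] --> \int[mu]_x (f x)%:E)%E.

(* Main.v *)
(* The quantile function of mu is the left adjoint of its cdf F, so the value of
   the push-forward's cdf at t is the total mass of the atoms y_j of sigma at
   which the cdf G of sigma is at most u := F t. These atoms form an initial
   segment; the last of them gives the upper bound u on their mass, and the
   first atom beyond them, where G already exceeds u, shows that this mass
   misses u by at most one atom of sigma.

   A uniform bound c between two cdfs bounds the difference of the masses of any
   point by 2c, so the masses of the atoms x_i of mu converge. These limits add
   up to 1, hence the mass outside of the x_i vanishes in the limit, and the
   integral of a bounded f converges to the sum of the f (x_i) mu {x_i}. *)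
From HB Require Import structures.
Require Import Defs.
From mathcomp Require Import all_boot all_order all_algebra.
From mathcomp Require Import all_classical all_reals all_analysis.
From mathcomp Require Import measurable_realfun lra.

Set Implicit Arguments.
Unset Strict Implicit.
Unset Printing Implicit Defensive.

Import Order.TTheory GRing.Theory Num.Theory.
Import numFieldNormedType.Exports.

Local Open Scope classical_set_scope.
Local Open Scope ring_scope.

(** * Distribution functions: quantile adjunction and point masses *)

Section cumul.
Context (R : realType).
Implicit Types mu nu sigma : borel_prob R.

Lemma cumul_ge0 mu t : 0 <= cumul mu t.
Proof. exact: fine_ge0. Qed.

Lemma cumul_le1 mu t : cumul mu t <= 1.
Proof. by rewrite -lee_fin fineK ?fin_num_measure// probability_le1. Qed.

(** [cumul] is the real-valued [cdf] of the identity seen as a random variable, so the limit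
    theorems on [cdf] apply to it. *)
Let idR : measurableTypeR R -> R := idfun.

#[local] HB.instance Definition _ :=
  @isMeasurableFun.Build _ _ _ _ idR (@measurable_id _ _ setT).

Lemma cvg_cumulNy mu : cumul mu r @[r --> -oo] --> (0 : R).
Proof. exact/fine_cvg/(@cvg_cdfNy0 _ _ _ mu idR). Qed.

Lemma cumul_right_continuous mu : right_continuous (cumul mu).
Proof.
move=> a; apply: fine_cvg; rewrite fineK ?fin_num_measure//.
exact: (@cdf_right_continuous _ _ _ mu idR).
Qed.

(** The set defining the infimum is nonempty by assumption and bounded below because [cumul mu]
    tends to 0 < [s] at -oo; right-continuity puts the infimum in the set. *)
Lemma quantile_le mu s t : 0 < s -> (exists a, s <= cumul mu a) ->
  (quantile mu s <= t) = (s <= cumul mu t).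
Proof.
move=> s_gt0 [a sa]; pose S := [set r | s <= cumul mu r].
have infS : has_inf S.
  split; first by exists a.
  have [b [_ bs]] : -oo%R (fun r => cumul mu r < s).
    by near=> r; near: r; exact: (cvgr_lt _ (cvg_cumulNy mu)).
  exists (b - 1) => r Sr; rewrite leNgt; apply/negP => rb.
  have /bs : r < b by rewrite (lt_trans rb)// ltrBlDr ltrDl.
  by rewrite ltNge Sr.
apply/idP/idP => [qt|st]; last by apply: ge_inf => //; exact: infS.2.
apply: le_trans (cumul_nondecreasing mu qt).
apply: (cvgr_to_ge (@cumul_right_continuous mu (quantile mu s))).
near=> r; have qr : quantile mu s < r by [].
have [u Su /ltW ur] := inf_lt infS.1 qr.
exact: le_trans Su (cumul_nondecreasing mu ur).
Unshelve. all: by end_near. Qed.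

Lemma cumul_itv nu a b : a <= b ->
  fine (nu `]a, b]%classic) = cumul nu b - cumul nu a.
Proof.
move=> ab; rewrite /cumul -fineB ?fin_num_measure//; congr fine.
have -> : `]a, b]%classic = `]-oo, b] `\` `]-oo, a] => [|].
  by rewrite -[RHS]setCK setCD setCitvl setUC -[LHS]setCK setCitv.
rewrite measureD ?setIidr//; first exact: subset_itvl.
by rewrite -ge0_fin_numE// fin_num_measure.
Qed.

(** The intervals []a - k.+1%:R^-1, a]] decrease to the singleton: continuity from above. *)
Lemma cvg_cumul_set1 nu a :
  cumul nu a - cumul nu (a - k.+1%:R^-1) @[k --> \oo] --> fine (nu [set a]).
Proof.
rewrite set1_bigcap_oc.
under eq_cvg do rewrite -cumul_itv ?gerBl//.
apply: fine_cvg; rewrite fineK; last first.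
  by rewrite fin_num_measure//; exact: bigcap_measurable.
apply: nonincreasing_cvg_mu => //.
- by rewrite -ge0_fin_numE// fin_num_measure.
- exact: bigcap_measurable.
- move=> i j ij; apply/subsetPset/subset_itvr.
  by rewrite bnd_simp lerD2l lerN2 lef_pV2 ?posrE// ler_nat.
Qed.

(** A point mass is a limit of increments of the cdf, and each increment costs [c] at each of its
    two ends. *)
Lemma dist_set1_cumul mu nu c a : (forall t, `|cumul nu t - cumul mu t| <= c) ->
  `|fine (nu [set a]) - fine (mu [set a])| <= c + c.
Proof.
move=> numu.
have h : `|cumul nu a - cumul nu (a - k.+1%:R^-1) -
    (cumul mu a - cumul mu (a - k.+1%:R^-1))| @[k --> \oo] -->
    `|fine (nu [set a]) - fine (mu [set a])|.
  exact: cvg_norm (cvgB (@cvg_cumul_set1 nu a) (@cvg_cumul_set1 mu a)).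
apply: (cvgr_to_le h); apply: nearW => k.
rewrite (_ : _ - _ = cumul nu a - cumul mu a -
  (cumul nu (a - k.+1%:R^-1) - cumul mu (a - k.+1%:R^-1))); last by lra.
by rewrite (le_trans (ler_normB _ _))// lerD.
Qed.

End cumul.

(** * Atomic measures and the cdf of the push-forward *)

Section atomic.
Context (R : realType).
Implicit Types mu sigma : borel_prob R.

Lemma atomicE n (p x : 'I_n -> R) (A : set (measurableTypeR R)) :
  atomic p x A = (\sum_(i < n | x i \in A) p i)%:E.
Proof.
rewrite /atomic [in RHS]big_mkcond -sumEFin; apply: eq_bigr => i _.
by rewrite diracE -EFinM; case: ifP => _; rewrite ?(mulr1, mulr0).
Qed.

Lemma cumul_atomic n (p x : 'I_n -> R) mu t :
  (forall A, measurable A -> mu A = atomic p x A) ->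
  cumul mu t = \sum_(i < n | x i <= t) p i.
Proof.
move=> muE; rewrite /cumul muE// atomicE; apply: eq_bigl => i.
by rewrite mem_setE in_itv.
Qed.

(** Supplies the attained level that [quantile_le] asks for. Any point at or beyond all atoms works,
    so the base value 0 of the maximum is harmless. *)
Lemma cumul_atomic1 n (p x : 'I_n -> R) mu : \sum_(i < n) p i = 1 ->
  (forall A, measurable A -> mu A = atomic p x A) ->
  exists a, cumul mu a = 1.
Proof.
move=> p1 muE; exists (\big[Num.max/0]_(i < n) x i).
by rewrite (cumul_atomic _ muE) -p1; apply: eq_bigl => i; exact: le_bigmax.
Qed.

Lemma le_sum_subpred (I : finType) (P Q : pred I) (q : I -> R) :
  (forall i, 0 <= q i) -> (forall i, P i -> Q i) ->
  \sum_(i | P i) q i <= \sum_(i | Q i) q i.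
Proof.
move=> q0 PQ; rewrite big_mkcond [leRHS]big_mkcond; apply: ler_sum => i _.
by case: ifP => [/PQ ->//|_]; case: ifP.
Qed.

Lemma dist_sum_le m (q y : 'I_m -> R) (u : R) :
  injective y -> (forall j, 0 <= q j) -> \sum_(j < m) q j = 1 -> 0 <= u <= 1 ->
  `|\sum_(j < m | \sum_(i < m | y i <= y j) q i <= u) q j - u| <=
    \big[Num.max/0]_(j < m) q j.
Proof.
move=> yI q0 q1 /andP[u0 u1].
set G := fun j => \sum_(i < m | y i <= y j) q i.
set s := \sum_(j < m | _) q j.
have G_mono i j : y i <= y j -> G i <= G j.
  by move=> ij; apply: le_sum_subpred => // k /le_trans; exact.
have su : s <= u.
  have [j0 Gj0|none] := pickP (fun j => G j <= u); last by rewrite /s big_pred0.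
  (* [j] is the last selected atom: all selected ones lie at or to the left of it, so [s <= G j]. *)
  case: (@arg_maxP _ _ _ j0 (fun j => G j <= u) y Gj0) => j Gj jmax.
  by apply: le_trans Gj; apply: le_sum_subpred => // i /jmax.
have us : u <= s + \big[Num.max/0]_(j < m) q j.
  have [j0 Gj0|none] := pickP (fun j => ~~ (G j <= u)); last first.
    (* If every atom is selected, [s] is 1 and [u <= 1] suffices. *)
    rewrite /s (eq_bigl predT) ?q1; last by move=> j; exact/negbFE/none.
    by rewrite (le_trans u1)// lerDl bigmax_idl le_max lexx.
  (* [j] is the first atom with [u < G j]; those before it are selected, so [G j <= s + q j]. *)
  case: (@arg_minP _ _ _ j0 (fun j => ~~ (G j <= u)) y Gj0) => j Gj jmin.
  rewrite -ltNge in Gj; apply: (le_trans (ltW Gj)).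
  apply: (@le_trans _ _ (s + q j)); last by rewrite lerD2l; exact: le_bigmax.
  rewrite /G (bigD1 j)//= addrC lerD2r; apply: le_sum_subpred => // i.
  move=> /andP[ij iNj]; apply: contraNT iNj => /jmin ji.
  by apply/eqP/yI/le_anti; rewrite ij.
by rewrite ler_distl; lra.
Qed.

Lemma dist_cumul_push_cdt m (q y : 'I_m -> R) mu sigma t :
  (exists a, cumul mu a = 1) -> injective y ->
  (forall j, 0 < q j) -> \sum_(j < m) q j = 1 ->
  (forall A, measurable A -> sigma A = atomic q y A) ->
  `|cumul (push_cdt mu sigma) t - cumul mu t| <= \big[Num.max/0]_(j < m) q j.
Proof.
move=> [a mua] yI q0 q1 sigmaE.
have q_ge0 j : 0 <= q j by exact: ltW.
suff -> : cumul (push_cdt mu sigma) t =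
    \sum_(j < m | \sum_(i < m | y i <= y j) q i <= cumul mu t) q j.
  by apply: dist_sum_le => //; rewrite cumul_ge0 cumul_le1.
rewrite [LHS](_ : _ = fine (sigma (cdt mu sigma @^-1` `]-oo, t]%classic)))//.
rewrite sigmaE; last exact: measurable_funPTI.
rewrite atomicE; apply: eq_bigl => j.
rewrite [LHS](_ : _ = (cdt mu sigma (y j) <= t)); last by rewrite mem_setE.
(* The level [cumul sigma (y j)] is positive since it includes [q j], and it is at most 1, which
   [cumul mu] attains. *)
rewrite -(cumul_atomic _ sigmaE) quantile_le//.
  rewrite (cumul_atomic _ sigmaE) (bigD1 j)//= ltr_pwDl//.
  exact: sumr_ge0.
by exists a; rewrite mua cumul_le1.
Qed.

End atomic.

(** * Integrals of bounded functions and masses of atoms *)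

Section integral_atoms.
Context (R : realType).
Implicit Types mu nu : borel_prob R.

(** Meant for the coefficients [f (x i)] and [- M]; integrability is recorded too because splitting
    integrals of sums and differences requires it. *)
Lemma Rintegral_sum_indic nu n (c : 'I_n -> R)
    (A : 'I_n -> set (measurableTypeR R)) :
  (forall i, measurable (A i)) ->
  nu.-integrable setT (EFin \o (fun z => \sum_(i < n) c i * \1_(A i) z)) /\
  \int[nu]_z (\sum_(i < n) c i * \1_(A i) z) =
    \sum_(i < n) c i * fine (nu (A i)).
Proof.
move=> mA.
have intA i : nu.-integrable setT (fun z => (c i)%:E * (\1_(A i) z)%:E)%E.
  by apply: integrableZl => //; exact: integrable_indic.
have sumE : EFin \o (fun z => \sum_(i < n) c i * \1_(A i) z) =
    (fun z => \sum_(i < n) (c i)%:E * (\1_(A i) z)%:E)%E.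
  by apply/funext => z /=; rewrite -sumEFin; apply: eq_bigr => i _.
split; first by rewrite sumE; exact: integrable_sum.
rewrite /Rintegral [X in fine X](_ : _ =
    \int[nu]_z (\sum_(i < n) (c i)%:E * (\1_(A i) z)%:E))%E; last first.
  by apply: eq_integral => z _; rewrite -(congr1 (@^~ z) sumE).
rewrite integral_sum// (eq_bigr (fun i => (c i * fine (nu (A i)))%:E)).
  by rewrite sumEFin.
move=> i _; rewrite integralZl//; last exact: integrable_indic.
by rewrite integral_indic// setIT EFinM fineK ?fin_num_measure.
Qed.

(* The integrand on the left is dominated by [M] times the indicator function of
   the complement of the atoms, which integrates to the right-hand side. *)
Lemma dist_Rintegral_atoms nu n (x : 'I_n -> R) (f : R -> R) (M : R) :
  injective x -> measurable_fun setT f -> (forall z, `|f z| <= M) ->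
  `|\int[nu]_z f z - \sum_(i < n) f (x i) * fine (nu [set x i])| <=
    M * (1 - \sum_(i < n) fine (nu [set x i])).
Proof.
move=> xI mf fM.
have m1 i : measurable [set x i] by exact: measurable_set1.
have [intS ES] := Rintegral_sum_indic nu (fun i => f (x i)) m1.
have [int1 E1] := Rintegral_sum_indic nu (fun=> - M) m1.
have intf : nu.-integrable setT (EFin \o f).
  apply: measurable_bounded_integrable => //.
    by rewrite -ge0_fin_numE// fin_num_measure.
  exists M; split; first exact: num_real.
  by move=> K MK z _ /=; rewrite (le_trans (fM z))// ltW.
have intM : nu.-integrable setT (EFin \o (fun=> M) : R -> \bar R).
  exact: finite_measure_integrable_cst.
have intB : nu.-integrable setT
    (EFin \o (fun z => f z - \sum_(i < n) f (x i) * \1_[set x i] z)).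
  exact (integrableB measurableT intf intS).
(* As the [x i] are distinct, this integrand is [M] times the indicator of the complement of the
   atoms. *)
have intD : nu.-integrable setT
    (EFin \o (fun z => M + \sum_(i < n) - M * \1_[set x i] z)).
  exact (integrableD measurableT intM int1).
rewrite -ES -RintegralB//.
rewrite (_ : M * _ = \int[nu]_z (M + \sum_(i < n) - M * \1_[set x i] z));
    last first.
  rewrite RintegralD// E1 Rintegral_cst//.
  rewrite [X in _ = M * X + _](congr1 fine (probability_setT nu)) -mulr_sumr.
  by rewrite mulNr mulrBr.
apply: (le_trans (le_normr_Rintegral measurableT intB)).
apply: le_Rintegral => //.
  by have := integrable_norm intB.
move=> z _.
(* Off the atoms both sums vanish and [|f z| <= M] remains; at an atom one term of each sum survives
   and both sides are 0. *)
have [i xz|none] := pickP (fun i => x i == z); last first.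
  have sum0 (c : 'I_n -> R) : \sum_(i < n) c i * \1_[set x i] z = 0.
    rewrite big1// => i _; rewrite indicE memNset ?mulr0//= => zx.
    by move: (none i); rewrite zx eqxx.
  by rewrite !sum0 subr0 addr0.
have sumz (c : 'I_n -> R) : \sum_(j < n) c j * \1_[set x j] z = c i.
  rewrite (bigD1 i)//= indicE mem_set/= ?(eqP xz)// mulr1 big1 ?addr0// => j ji.
  rewrite indicE memNset ?mulr0//= => zx; move/negP: ji; apply.
  by apply/eqP/xI; rewrite -zx (eqP xz).
by rewrite !sumz (eqP xz) !subrr normr0.
Qed.

Lemma weak_cvg_atoms (nu : nat -> borel_prob R) mu n (x : 'I_n -> R) :
  injective x -> \sum_(i < n) fine (mu [set x i]) = 1 ->
  (forall i, fine (nu N [set x i]) @[N --> \oo] --> fine (mu [set x i])) ->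
  weak_cvg nu mu.
Proof.
move=> xI mu1 nux f fcont [M0 [_ /(_ (M0 + 1))fM]].
(* [bounded_fun] grants every bound strictly above [M0]. *)
have {}fM z : `|f z| <= M0 + 1 by apply: fM => //; rewrite ltrDl.
have mf : measurable_fun setT f by exact: continuous_measurable_fun.
have intE (P : borel_prob R) :
    (\int[P]_z (f z)%:E = (\int[P]_z f z)%:E)%E.
  rewrite fineK//; apply: integrable_fin_num => //.
  apply: measurable_bounded_integrable => //.
    by rewrite -ge0_fin_numE// fin_num_measure.
  exists (M0 + 1); split; first exact: num_real.
  by move=> K MK z _ /=; rewrite (le_trans (fM z))// ltW.
rewrite intE; under eq_cvg do rewrite intE.
apply: cvg_EFin; first by apply: nearW.
have dist P := dist_Rintegral_atoms P xI mf fM.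
pose S (P : borel_prob R) := \sum_(i < n) f (x i) * fine (P [set x i]).
(* The atoms carry all of [mu], so its error bound is 0. *)
have -> : \int[mu]_z f z = S mu.
  apply/eqP; rewrite -subr_eq0 -normr_le0 (le_trans (dist mu))//.
  by rewrite mu1 subrr mulr0.
have cvgS : S (nu N) @[N --> \oo] --> S mu.
  by apply: cvg_big => [|i _]; [exact: add_continuous|exact: cvgMl_tmp].
have cvgE : (M0 + 1) * (1 - \sum_(i < n) fine (nu N [set x i]))
    @[N --> \oo] --> 0.
  rewrite -[X in _ --> X](mulr0 (M0 + 1)); apply: cvgMl_tmp.
  rewrite -[X in _ --> X](subrr 1) -[X in _ --> _ - X]mu1.
  by apply: cvgB; [exact: cvg_cst|apply: cvg_big => //; exact: add_continuous].
rewrite -[X in _ --> X]addr0.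
rewrite [X in X @ _](_ : _ =
    (fun N => S (nu N) + (\int[nu N]_z f z - S (nu N)))); last first.
  by apply/funext => N /=; rewrite addrC subrK.
apply: cvgD => //; apply: norm_cvg0.
apply: (squeeze_cvgr _ (cvg_cst 0) cvgE); apply: nearW => N.
by rewrite normr_ge0 dist.
Qed.

End integral_atoms.

Theorem theorem5p5 (R : realType)
    (n : nat) (x p : 'I_n -> R) (mu : borel_prob R)
    (m : nat -> nat) (y q : forall N : nat, 'I_(m N) -> R)
    (sigma : nat -> borel_prob R)
    (x_incr : {homo x : i j / (i < j)%N >-> i < j})
    (p_gt0 : forall i, 0 < p i)
    (p_sum1 : \sum_(i < n) p i = 1)
    (muE : forall A, measurable A -> mu A = atomic p x A)
    (y_incr : forall N, {homo y N : i j / (i < j)%N >-> i < j})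
    (q_gt0 : forall N j, 0 < q N j)
    (q_sum1 : forall N, \sum_(j < m N) q N j = 1)
    (sigmaE : forall N A, measurable A -> sigma N A = atomic (q N) (y N) A)
    (* all masses are positive, so the base value 0 does not affect the max *)
    (q_max : \big[Num.max/0]_(j < m N) q N j @[N --> \oo] --> 0) :
  (supnorm (cumul (push_cdt mu (sigma N)) \- cumul mu) @[N --> \oo] --> 0%E) /\
  weak_cvg (fun N => push_cdt mu (sigma N)) mu.
Proof.
have incr_inj k (z : 'I_k -> R) :
    {homo z : i j / (i < j)%N >-> i < j} -> injective z.
  move=> z_incr i j zij; apply/val_inj => /=.
  by case: (ltngtP i j) => // /z_incr; rewrite zij ltxx.
have xI := incr_inj _ _ x_incr.
(* This bound is uniform in [t]: it controls the supremum norm and, through [dist_set1_cumul], the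
   point masses. *)
have dist N t := dist_cumul_push_cdt t (cumul_atomic1 p_sum1 muE)
  (incr_inj _ _ (y_incr N)) (q_gt0 N) (q_sum1 N) (sigmaE N).
split.
  have maxE : (\big[Num.max/0]_(j < m N) q N j)%:E @[N --> \oo] --> 0%E.
    by apply: cvg_EFin => //; exact: nearW.
  apply: (squeeze_cvge _ (cvg_cst 0%E) maxE).
  apply: nearW => N; apply/andP; split.
    (* Any point witnesses that the supremum is nonnegative; 0 is an arbitrary choice. *)
    apply: le_trans (ereal_sup_ubound _); last by exists 0.
    by rewrite lee_fin.
  by apply: ge_ereal_sup => _ [t _ <-]; rewrite lee_fin; exact: dist.
apply: (weak_cvg_atoms xI).
  rewrite -p_sum1; apply: eq_bigr => i _.
  rewrite muE// atomicE /= (big_pred1 i)// => j /=.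
  by apply/idP/eqP => [|->]; rewrite inE//= => /xI.
move=> i; apply/cvgrPdist_le => e e0.
(* Half of [e], since [dist_set1_cumul] doubles the uniform bound. *)
have /cvgrPdist_le/(_ (e / 2)) := q_max.
rewrite divr_gt0// => /(_ isT); apply: filterS => N; rewrite sub0r normrN => qe.
rewrite distrC (le_trans (dist_set1_cumul _ (dist N)))//.
by have := le_trans (ler_norm _) qe; lra.
Qed.
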